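(* Let $H = H_0\tau_z + H_M + \Delta'\tau_x + \Delta''\tau_y$ be a Bogoliubov–de Gennes Hamiltonian as defined in the context, i.e. $$H=\begin{pmatrix} H_0+H_M & \Delta'-i\Delta''\\ \Delta'+i\Delta'' & -H_0+H_M\end{pmatrix},$$ where $H_0,\Delta',\Delta''$ are Hermitian and time-reversal even and $H_M$ is Hermitian and time-reversal odd. Let $\lambda_+$ and $\lambda_-$ be the smallest eigenvalues of $\Delta'+H_M$ and $\Delta'-H_M$ respectively, and let $E_G$ be the energy gap of $H$. Then $$E_G \ge \max(\lambda_+,\lambda_-).$$ Moreover, if $\max(\lambda_+,\lambda_-)>0$, then $H$ is topologically trivial.
   Context: Fix an integer $d\ge 0$ (spatial dimension) and $N\ge 1$ (number of degrees of freedom per unit cell: orbital, spin, position within the cell, etc.). A translation-invariant (periodic) Hermitian operator on the $N$-dimensional internal space is a continuous map $A:\mathbb{T}^d\to\mathbb{C}^{N\times N}$ from the Brillouin torus $\mathbb{T}^d=(\mathbb{R}/2\pi\mathbb{Z})^d$ with $A(k)=A(k)^\dagger$ for all $k$ (for $d=0$ this is just a Hermitian matrix). An eigenvalue of $A$ means an eigenvalue of $A(k)$ for some $k$; by compactness a smallest eigenvalue exists. Time reversal is an antiunitary operator $\mathcal{T}=VK$, with $V$ a fixed ($k$-independent) unitary $N\times N$ matrix, $K$ complex conjugation, and $\mathcal{T}^2=\pm1$. It acts by $(\mathcal{T}A\mathcal{T}^{-1})(k)=V\,\overline{A(-k)}\,V^{-1}$. $A$ is time-reversal even if $\mathcal{T}A\mathcal{T}^{-1}=A$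 and time-reversal odd if $\mathcal{T}A\mathcal{T}^{-1}=-A$. $\tau_x,\tau_y,\tau_z$ are the Pauli matrices in particle-hole space $\mathbb{C}^2$; $A\tau_j$ means $\tau_j\otimes A$, and $A$ alone means $1_2\otimes A$. A BdG Hamiltonian is $H=H_0\tau_z+H_M+\Delta'\tau_x+\Delta''\tau_y$, with $H_0,\Delta',\Delta''$ translation-invariant Hermitian time-reversal even and $H_M$ translation-invariant Hermitian time-reversal odd. Equivalently, $H$ is a continuous family of Hermitian $2N\times 2N$ matrices with particle-hole symmetry $\mathcal{P}H\mathcal{P}^{-1}=-H$, where $\mathcal{P}=i\tau_y\mathcal{T}$. The energy gap of $H$ is $E_G=\min\{|E| : E \text{ an eigenvalue of } H(k) \text{ for some } k\in\mathbb{T}^d\}$; $H$ is gapped if $E_G>0$. A gapped $H$ is topologically trivial if there is a continuous path $s\mapsto H_s$, $s\in[0,1]$ (jointly continuous in $(s,k)$), of gapped BdG Hamiltonians, i.e. gapped Hamiltonians of the form $A_s\tau_z+B_s+C_s\tau_x+D_s\tau_y$ with $A_s,C_s,D_s$ translation-invariant Hermitian time-reversal even and $B_s$ translation-invariant Hermitian time-reversal odd (hence $\mathcal{P}$-symmetric), from $H_0:=H$ at $s=0$ to the onsite potential $\tau_z\otimes 1_N$ at $s=1$; if in addition $H$ is time-reversal symmetric, i.e. $(1_2\otimes\mathcal{T})H(1_2\otimes\mathcal{T})^{-1}=H$ (equivalently $H_M=0$ and $\Delta''=0$), every $H_s$ is required to be so as well. *)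

(* Defs.v *)
From HB Require Import structures.
From mathcomp Require Import all_boot all_order all_algebra.
From mathcomp Require Import all_classical all_reals all_analysis.
From mathcomp Require Import complex.

Set Implicit Arguments.
Unset Strict Implicit.
Unset Printing Implicit Defensive.

Import Order.TTheory GRing.Theory Num.Theory.
Import numFieldNormedType.Exports.

Local Open Scope classical_set_scope.
Local Open Scope ring_scope.
Local Open Scope complex_scope.

(* R[i] packed as a numClosedFieldType: the topology that MathComp-Analysis puts
   on a numFieldType (here, the usual one of the plane) is inferred from this
   packed form, but not from the bare type R[i]. *)
Definition Cplx (R : realType) : numClosedFieldType := R[i].

Section Bloch.
Context {R : realType} {d : nat}.
Local Notation C := (Cplx R).

(* Functions on the Brillouin torus (R/2piZ)^d are encoded as functions on R^d
   that are 2pi-periodic in each coordinate; continuity on the torus is then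
   continuity on R^d. *)
Definition translation_invariant n (A : 'rV[R]_d -> 'M[C]_n) : Prop :=
  continuous A /\
  forall (k : 'rV[R]_d) (j : 'I_d), A (k + (2 * pi) *: delta_mx 0 j) = A k.

Definition periodic_hermitian n (A : 'rV[R]_d -> 'M[C]_n) : Prop :=
  translation_invariant A /\ forall k, A k \is hermsymmx.

(* T = V K is antiunitary with T^2 = V conj(V) = 1 or -1. *)
Definition time_reversal n (V : 'M[C]_n) : Prop :=
  V \is unitarymx /\
  (V *m map_mx Num.conj V = 1%:M \/ V *m map_mx Num.conj V = - 1%:M).

Definition tr_conj n (V : 'M[C]_n) (A : 'rV[R]_d -> 'M[C]_n)
    (k : 'rV[R]_d) : 'M[C]_n :=
  V *m map_mx Num.conj (A (- k)) *m invmx V.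

Definition tr_even n (V : 'M[C]_n) (A : 'rV[R]_d -> 'M[C]_n) : Prop :=
  forall k, tr_conj V A k = A k.

Definition tr_odd n (V : 'M[C]_n) (A : 'rV[R]_d -> 'M[C]_n) : Prop :=
  forall k, tr_conj V A k = - A k.

Definition spectrum n (A : 'rV[R]_d -> 'M[C]_n) : set C :=
  [set E | exists k, eigenvalue (A k) E].

(* lbound is taken for the partial order of R[i], which compares only numbers
   with equal imaginary part; eigenvalues of Hermitian matrices are real and
   hence comparable to l. *)
Definition smallest_eigenvalue n (A : 'rV[R]_d -> 'M[C]_n) (l : R) : Prop :=
  spectrum A l%:C /\ lbound (spectrum A) l%:C.

Definition energy_gap n (H : 'rV[R]_d -> 'M[C]_n) (EG : R) : Prop :=
  [set `|E| | E in spectrum H] EG%:C /\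
  lbound [set `|E| | E in spectrum H] EG%:C.

Definition gapped n (H : 'rV[R]_d -> 'M[C]_n) : Prop :=
  exists2 EG : R, energy_gap H EG & 0 < EG.

(* H0 tau_z + HM + D1 tau_x + D2 tau_y, the particle-hole space being the outer
   factor of the tensor product. *)
Definition bdg N (H0 HM D1 D2 : 'rV[R]_d -> 'M[C]_N)
    (k : 'rV[R]_d) : 'M[C]_(N + N) :=
  block_mx (H0 k + HM k) (D1 k - 'i *: D2 k)
           (D1 k + 'i *: D2 k) (- H0 k + HM k).

Definition is_bdg_data N (V : 'M[C]_N) (H0 HM D1 D2 : 'rV[R]_d -> 'M[C]_N) :
    Prop :=
  [/\ periodic_hermitian H0 /\ tr_even V H0,
      periodic_hermitian HM /\ tr_odd V HM,
      periodic_hermitian D1 /\ tr_even V D1 &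
      periodic_hermitian D2 /\ tr_even V D2].

Definition is_bdg N (V : 'M[C]_N) (H : 'rV[R]_d -> 'M[C]_(N + N)) : Prop :=
  exists H0 HM D1 D2, is_bdg_data V H0 HM D1 D2 /\ H = bdg H0 HM D1 D2.

(* block_mx V 0 0 V is the matrix of 1_2 (x) V. *)
Definition tr_symmetric N (V : 'M[C]_N) (H : 'rV[R]_d -> 'M[C]_(N + N)) : Prop :=
  tr_even (block_mx V 0 0 V) H.

Definition onsite_potential N (k : 'rV[R]_d) : 'M[C]_(N + N) :=
  block_mx 1%:M 0 0 (- 1%:M).

Definition topologically_trivial N (V : 'M[C]_N)
    (H : 'rV[R]_d -> 'M[C]_(N + N)) : Prop :=
  gapped H /\
  exists Hs : R -> 'rV[R]_d -> 'M[C]_(N + N),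
    [/\ {within `[0, 1] `*` setT,
           continuous (fun p : R * 'rV[R]_d => Hs p.1 p.2)},
        forall s : R, s \in `[0, 1] -> is_bdg V (Hs s) /\ gapped (Hs s),
        Hs 0 = H,
        Hs 1 = @onsite_potential N &
        tr_symmetric V H -> forall s : R, s \in `[0, 1] -> tr_symmetric V (Hs s)].

End Bloch.

(* Main.v *)
(* With h = D1 + HM tau_x (in block form), the anticommutator of the BdG
   Hamiltonian H with tau_x is 2h, since H0 tau_z and D2 tau_y anticommute with
   tau_x. The matrix h is unitarily equivalent to the direct sum of D1 + HM and
   D1 - HM, and time reversal exchanges these two up to k -> -k, so
   h >= l := max(lp, lm). If w is a unit eigenvector of H for E, then
   l <= <w, h w> = E <w, tau_x w> <= |E|.
   The bound involves neither H0 nor D2, so along the segment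
   (1 - s) H + s tau_z it gives a gap of at least (1 - s) l for s < 1, while
   tau_z itself is gapped. *)
Require Import Defs.
From mathcomp Require Import all_boot all_order all_algebra.
From mathcomp Require Import all_classical all_reals all_analysis.
From mathcomp Require Import complex ring lra.

Set Implicit Arguments.
Unset Strict Implicit.
Unset Printing Implicit Defensive.

Import Order.TTheory GRing.Theory Num.Theory.
Import numFieldNormedType.Exports.

Local Open Scope ring_scope.

(** * Hermitian forms, and the eigenvalue bound at a single momentum *)

Section Forms.
Context {C : numClosedFieldType}.
Implicit Types n : nat.
Local Open Scope sesquilinear_scope.

Lemma hermsymmxE n (A : 'M[C]_n) : (A \is hermsymmx) = (A ^t* == A).
Proof. by rewrite is_hermitianmxE expr0 scale1r eq_sym. Qed.

Lemma hermsymmx_tr n (A : 'M[C]_n) : A \is hermsymmx -> A ^t* = A.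
Proof. by rewrite hermsymmxE => /eqP. Qed.

(** Vectors are rows because [eigenvalue] refers to left eigenvectors. Values lie in [C] with its
    partial order, so an inequality between two of them also says that their difference is real. *)
Definition sqnorm n (x : 'rV[C]_n) : C := (x *m x ^t*) 0 0.

Definition qform n (A : 'M[C]_n) (x : 'rV[C]_n) : C := (x *m A *m x ^t*) 0 0.

Lemma sqnormE n (x : 'rV[C]_n) : sqnorm x = \sum_i `|x 0 i| ^+ 2.
Proof. by rewrite /sqnorm mxE; apply: eq_bigr => i _; rewrite !mxE normCK. Qed.

Lemma sqnorm_ge0 n (x : 'rV[C]_n) : 0 <= sqnorm x.
Proof. by rewrite sqnormE sumr_ge0 // => i _; rewrite exprn_ge0. Qed.

Lemma sqnorm_gt0 n (x : 'rV[C]_n) : x != 0 -> 0 < sqnorm x.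
Proof.
move=> x0; rewrite lt_def sqnorm_ge0 andbT; apply: contra x0.
rewrite sqnormE psumr_eq0 => [/allP x0|i _]; last by rewrite exprn_ge0.
apply/eqP/rowP => i; rewrite mxE; apply/eqP.
by move: (x0 i (mem_index_enum i)); rewrite sqrf_eq0 normr_eq0.
Qed.

Lemma qform_diag n (D x : 'rV[C]_n) :
  qform (diag_mx D) x = \sum_i D 0 i * `|x 0 i| ^+ 2.
Proof.
rewrite /qform mxE; apply: eq_bigr => i _.
by rewrite mul_mx_diag !mxE normCK mulrCA mulrA.
Qed.

Lemma sqnorm_unitary n (U : 'M[C]_n) (x : 'rV[C]_n) :
  U \is unitarymx -> sqnorm (x *m U) = sqnorm x.
Proof.
by move=> Uu; rewrite /sqnorm trmx_mul map_mxM mulmxA mulmxtVK.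
Qed.

Lemma eigenvalue_row n (A : 'M[C]_n) (x : 'rV[C]_n) (a : C) :
  x != 0 -> x *m A = a *: x -> eigenvalue A a.
Proof. by move=> x0 xA; apply/eigenvalueP; exists x. Qed.

Lemma hermsymmx_eigenvalue_real n (A : 'M[C]_n) (a : C) :
  A \is hermsymmx -> eigenvalue A a -> a \is Num.real.
Proof.
move=> /hermsymmx_tr Ah /eigenvalueP[x xA x0].
have xAC : A *m x ^t* = a^* *: x ^t*.
  by rewrite -{1}Ah -map_mxM -trmx_mul xA linearZ /= map_mxZ.
have : qform A x = a * sqnorm x by rewrite /qform xA -scalemxAl mxE.
rewrite /qform -mulmxA xAC -scalemxAr mxE => /mulIf/CrealP; apply.
by rewrite gt_eqF ?sqnorm_gt0.
Qed.

(** By the spectral theorem [A] is diagonal in a unitary basis; there the form is a sum of squared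
    moduli weighted by eigenvalues, each at least [l]. *)
Lemma qform_ge_eigenvalue n (A : 'M[C]_n) (l : C) :
  A \is hermsymmx -> (forall a, eigenvalue A a -> l <= a) ->
  forall x, l * sqnorm x <= qform A x.
Proof.
move=> Ah lA x; have /orthomx_spectralP AE := hermitian_normalmx Ah.
set P := spectralmx A in AE; set D := spectral_diag A in AE.
have Pu : P \is unitarymx := spectral_unitarymx A.
(* Row [i] of the diagonalizing matrix [P] is a left eigenvector of [A] for [D 0 i]; it is nonzero
   because it has norm 1. *)
have lD i : l <= D 0 i.
  apply/lA/(@eigenvalue_row _ _ (row i P)).
    apply/negP => /eqP Pi0; have /row_unitarymxP/(_ i i)/eqP := Pu.
    by rewrite Pi0 linear0l eqxx eq_sym oner_eq0.
  rewrite {1}AE !mulmxA -row_mul mulmxV ?unitarymx_unit // -mulmxA -row_mul.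
  by rewrite mul1mx mul_diag_mx; apply/rowP => j; rewrite !mxE.
rewrite -(@sqnorm_unitary _ (P ^t*)) ?trmxC_unitary //.
have -> : qform A x = qform (diag_mx D) (x *m P ^t*).
  by rewrite /qform {1}AE invmx_unitary // trmx_mul map_mxM trmxCK !mulmxA.
rewrite qform_diag sqnormE mulr_sumr ler_sum // => i _.
by rewrite ler_wpM2r // exprn_ge0.
Qed.

(** Since [V] is unitary, the left side is the form of the conjugate of [A] at [z = x *m V]. A 1 by
    1 matrix equals its transpose, and transposing the conjugate of a Hermitian [A] gives [A] back,
    now evaluated at the conjugate of [z]. *)
Lemma qform_conj n (V A : 'M[C]_n) (x : 'rV[C]_n) :
  V \is unitarymx -> A \is hermsymmx ->
  qform (V *m map_mx Num.conj A *m invmx V) x = qform A (map_mx Num.conj (x *m V)).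
Proof.
move=> Vu /hermsymmx_tr Ah; rewrite /qform invmx_unitary //.
rewrite !mulmxA -mulmxA -map_mxM -trmx_mul; move: (x *m V) => z.
have -> : (z *m map_mx Num.conj A *m z ^t*) 0 0 =
    (z *m map_mx Num.conj A *m z ^t*)^T 0 0 by rewrite [RHS]mxE.
rewrite !trmx_mul !map_trmx trmxK Ah mulmxA.
by rewrite -!map_mx_comp /= (map_mx_id (@conjCK _)).
Qed.

Lemma hermsymmx_bdg n (A B D E : 'M[C]_n) :
  A \is hermsymmx -> B \is hermsymmx -> D \is hermsymmx -> E \is hermsymmx ->
  block_mx (A + B) (D - 'i *: E) (D + 'i *: E) (- A + B) \is hermsymmx.
Proof.
move=> hA hB hD hE; rewrite hermsymmxE tr_block_mx map_block_mx; apply/eqP.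
congr block_mx; rewrite -?scaleNr linearD ?linearZ ?linearN /= map_mxD
  ?map_mxZ ?map_mxN /= ?rmorphN /= ?conjCi ?opprK !hermsymmx_tr //.
Qed.

(** The anticommutator argument at one momentum. For an eigenvector [w = (u, v)], the vectors
    [u + v] and [u - v] are, up to a factor, its components in the two eigenspaces of tau_x, on
    which the anticommutator acts through [D + B] and [D - B]. *)
Lemma bdg_eigenvalue_norm n (A B D E : 'M[C]_n) (i l a : C) :
  let H := block_mx (A + B) (D - i *: E) (D + i *: E) (- A + B) in
  H \is hermsymmx ->
  (forall x, l * sqnorm x <= qform (D + B) x) ->
  (forall x, l * sqnorm x <= qform (D - B) x) ->
  eigenvalue H a -> l <= `|a|.
Proof.
move=> H Hh lp lm Ha; have aR := hermsymmx_eigenvalue_real Hh Ha.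
have /eigenvalueP[w wH w0] := Ha.
(* The adjoint of [wH]: the eigenvalue reappears unconjugated because it is real. *)
have Hw : H *m w ^t* = a *: w ^t*.
  rewrite -{1}(hermsymmx_tr Hh) -map_mxM -trmx_mul wH linearZ /= map_mxZ.
  by rewrite /= (CrealP aR).
pose u := lsubmx w; pose v := rsubmx w.
have wE : w = row_mx u v by rewrite hsubmxK.
(* [T] is tau_x, and [x] below is the expectation value of [T] in [w]. *)
pose T : 'M[C]_(n + n) := block_mx 0 1%:M 1%:M 0.
have wCE : w ^t* = col_mx (u ^t*) (v ^t*) by rewrite wE tr_row_mx map_col_mx.
have anti : H *m T + T *m H = block_mx (D *+ 2) (B *+ 2) (B *+ 2) (D *+ 2).
  rewrite !mulmx_block !mulmx0 !mul0mx !mulmx1 !mul1mx !add0r !addr0.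
  rewrite add_block_mx !mulr2n; congr block_mx.
  - by rewrite addrACA addNr addr0.
  - by rewrite addrACA subrr add0r.
  - by rewrite addrACA addNr add0r.
  - by rewrite addrACA subrr addr0.
pose x := (u *m v ^t* + v *m u ^t*) 0 0.
have nE : sqnorm w = sqnorm u + sqnorm v.
  by rewrite /sqnorm wCE {1}wE mul_row_col mxE.
have ax : qform (H *m T + T *m H) w = 2 * (a * x).
  rewrite /qform mulmxDr mulmxDl mulmxA wH -!mulmxA Hw -scalemxAl -!scalemxAr.
  have -> : w *m (T *m w ^t*) = u *m v ^t* + v *m u ^t*.
    by rewrite wCE wE mul_block_col !mul0mx !mul1mx add0r addr0 mul_row_col.
  by rewrite -/x -mulr2n mulmxnE mxE -/x mulr_natl.
(* Polarization: the [D] terms mixing [u] with [v] cancel, as do the [B] terms that do not mix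
   them. *)
have qE : qform (H *m T + T *m H) w = qform (D + B) (u + v) + qform (D - B) (u - v).
  rewrite anti /qform wCE {1}wE mul_row_block mul_row_col.
  rewrite !mulr2n !linearD !linearN /= !map_mxD !map_mxN.
  rewrite !(mulmxDl, mulmxDr, mulNmx, mulmxN) !mxE.
  ring.
have sqD : sqnorm (u + v) = sqnorm w + x.
  rewrite nE /sqnorm /x !linearD /= !map_mxD !(mulmxDl, mulmxDr) !mxE; ring.
have sqB : sqnorm (u - v) = sqnorm w - x.
  rewrite nE /sqnorm /x !linearD !linearN /= !map_mxD !map_mxN.
  rewrite !(mulmxDl, mulmxDr, mulNmx, mulmxN) !mxE; ring.
have w_gt0 : 0 < sqnorm w by exact: sqnorm_gt0.
have xR : x \is Num.real.
  have -> : x = sqnorm (u + v) - sqnorm w by rewrite sqD; ring.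
  by rewrite rpredB // ger0_real // sqnorm_ge0.
(* This is Cauchy-Schwarz for [T], read off from the nonnegativity of [sqnorm (u + v)] and
   [sqnorm (u - v)]. *)
have xw : `|x| <= sqnorm w.
  rewrite real_ler_norml //; apply/andP; split; rewrite -subr_ge0.
    by rewrite opprK addrC -sqD sqnorm_ge0.
  by rewrite -sqB sqnorm_ge0.
(* When the bounds at [u + v] and [u - v] are added, the contributions of [x] cancel and leave twice
   [l * sqnorm w]. *)
have lax : l * sqnorm w <= a * x.
  rewrite -(ler_pM2l (ltr0n _ 2)) -ax qE.
  apply: le_trans (lerD (lp _) (lm _)).
  by rewrite sqD sqB le_eqVlt; apply/orP; left; apply/eqP; ring.
rewrite -(ler_pM2r w_gt0); apply: le_trans lax _.
apply: le_trans (real_ler_norm (rpredM aR xR)) _.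
by rewrite normrM ler_wpM2l.
Qed.

End Forms.

(** * Continuity of matrix-valued maps, determinants and the embedding of the reals *)

Section Continuity.
Local Open Scope classical_set_scope.

Lemma filter_forall_fin (T : Type) (F : set_system T) (I : finType)
    (P : I -> set T) :
  Filter F -> (forall i, F (P i)) -> F [set x | forall i, P i x].
Proof.
move=> FF FP; suff FPs (s : seq I) : F [set x | forall i, i \in s -> P i x].
  by apply: filterS (FPs (enum I)) => x Px i; apply: Px; rewrite mem_enum.
elim: s => [|i s IHs]; first by apply: filterS filterT => x _ j.
apply: filterS (filterI (FP i) IHs) => x [Pi Ps] j.
by rewrite in_cons => /predU1P[->|/Ps].
Qed.

Lemma continuous_mx (T : topologicalType) (K : numFieldType) m n
    (f : T -> 'M[K]_(m, n)) :
  (forall i j, continuous (fun t => f t i j)) -> continuous f.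
Proof.
move=> fc t A [P /= fP sPA]; rewrite nbhs_filterE /=.
suff : nbhs t [set s | forall i j, P i j (f s i j)].
  by apply: filterS => s; exact: sPA.
by apply: filter_forall_fin => i; apply: filter_forall_fin => j; exact/fc/fP.
Qed.

Lemma continuous_entry (T : topologicalType) (K : numFieldType) m n
    (f : T -> 'M[K]_(m, n)) i j :
  continuous f -> continuous (fun t => f t i j).
Proof.
move=> fc t; exact: (continuous_comp (fc t) (@coord_continuous K m n i j (f t))).
Qed.

Lemma continuous_det (T : topologicalType) (K : numFieldType) n
    (f : T -> 'M[K]_n) :
  continuous f -> continuous (fun t => \det (f t)).
Proof.
move=> fc; apply: continuous_big => [|s _ t]; first exact: add_continuous.
apply: cvgM; first exact: cvg_cst.
apply: cvg_big => [|i _]; first exact: mul_continuous.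
exact: continuous_entry.
Qed.

Lemma normr_real_complex (R : realType) (x : R) :
  `|x%:C%C : Cplx R| = `|x|%:C%C.
Proof. by rewrite normc_def /= expr0n addr0 sqrtr_sqr. Qed.

Lemma real_complex_continuous (R : realType) :
  continuous ((fun x => x%:C%C) : R -> Cplx R).
Proof.
(* The radius of a ball in [Cplx R] is itself a complex number; its positivity forces the imaginary
   part [e'] to vanish, so [e] serves as the real radius. *)
move=> x A /nbhs_ballP[[e e'] /=]; rewrite ltcE /= => /andP[/eqP-> e0] eA.
apply/nbhs_ballP; exists e => // y xy; apply: eA; move: xy.
by rewrite /ball /= -(rmorphB (real_complex R)) normr_real_complex ltcR.
Qed.

End Continuity.

(** * Eigenvalues as zeros of a determinant, and existence of the energy gap *)

Lemma eigenvalue_det (F : fieldType) n (A : 'M[F]_n) (a : F) :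
  eigenvalue A a = (\det (A - a%:M) == 0).
Proof.
by rewrite /eigenvalue kermx_eq0 row_free_unit unitmxE unitfE negbK.
Qed.

Section EnergyGap.
Context {R : realType} {d : nat}.
Local Notation C := (Cplx R).
Local Open Scope classical_set_scope.
Local Open Scope complex_scope.

Lemma translation_invariant_shift n (A : 'rV[R]_d -> 'M[C]_n)
    (z : 'I_d -> int) k :
  translation_invariant A -> A (k + \row_j (2 * pi * (z j)%:~R)) = A k.
Proof.
move=> [_ perA]; rewrite [X in k + X]row_sum_delta.
pose shift v := forall k, A (k + v) = A k.
apply: (big_ind shift) => [k'|u v Au Av k'|j _ k'] {k}; first by rewrite addr0.
- by rewrite addrA Av Au.
- rewrite mxE mulrC -scalerA; set e := (2 * pi) *: _.
  have addn (m : nat) k : A (k + m%:R *: e) = A k.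
    elim: m => [|m IHm]; first by rewrite scale0r addr0.
    by rewrite -natr1 scalerDl scale1r addrA perA.
  (* [Negz m] stands for [- m.+1]: invariance under this backward shift is [addn] for [m.+1]
     periods, applied at the shifted point. *)
  case: (z j) => m; first exact: addn.
  by rewrite NegzE mulrNz scaleNr -[LHS](addn m.+1) subrK.
Qed.

(** The box keeps both of its faces in each direction, so it covers the torus with overlap but is
    compact. *)
Definition brillouin_box : set 'rV[R]_d :=
  [set k | forall j, `[0, 2 * pi] (k ord0 j)].

Lemma brillouin_box_compact : compact brillouin_box.
Proof.
apply: (@rV_compact R d (fun=> `[0, 2 * pi])) => _.
exact: segment_compact.
Qed.

Lemma translation_invariant_box n (A : 'rV[R]_d -> 'M[C]_n) k :
  translation_invariant A -> exists2 k', brillouin_box k' & A k' = A k.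
Proof.
move=> perA; pose z j : int := - Num.floor (k 0 j / (2 * pi)).
exists (k + \row_j (2 * pi * (z j)%:~R)); last exact: translation_invariant_shift.
have pi2_gt0 : 0 < 2 * pi :> R by rewrite mulr_gt0 // pi_gt0.
move=> j; rewrite /= !mxE in_itv /= mulrNz mulrN.
set x := k ord0 j; set f := Num.floor _.
have : f%:~R <= x / (2 * pi) < (f + 1)%:~R by exact: floor_itv.
rewrite ler_pdivlMr // ltr_pdivrMr // intrD => /andP[].
nra.
Qed.

(** The pairs of a momentum and a real eigenvalue form the zero set of a continuous determinant,
    hence a closed set. Periodicity confines momenta to a compact box and one known eigenvalue
    bounds the energies of interest, so the modulus of the energy attains its minimum. *)
Lemma periodic_hermitian_energy_gap n (A : 'rV[R]_d -> 'M[C]_n) :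
  (0 < n)%N -> periodic_hermitian A -> exists EG, energy_gap A EG.
Proof.
move=> n0 [perA herA]; have [contA _] := perA.
have eigR k a : eigenvalue (A k) a -> exists x : R, a = x%:C.
  by move=> /(hermsymmx_eigenvalue_real (herA k))/complex_realP.
(* Some eigenvalue [x0] at momentum 0 exists because the field is algebraically closed and [n] is
   positive; it supplies the energy cutoff in [K]. *)
have [a Aa] := eigenvalue_closed (A 0) n0; have [x0 ax0] := eigR _ _ Aa.
rewrite {a}ax0 in Aa.
pose Z := [set p : 'rV[R]_d * R | \det (A p.1 - p.2%:C%:M) = 0].
have ZE k x : Z (k, x) <-> eigenvalue (A k) x%:C.
  by rewrite eigenvalue_det; split => /eqP.
pose K := brillouin_box `*` `[- `|x0|, `|x0|].
have clZ : closed Z.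
  have contD : continuous (fun p : 'rV[R]_d * R => \det (A p.1 - p.2%:C%:M)).
    apply: continuous_det; apply: continuous_mx => i j p.
    under eq_fun do rewrite !mxE.
    apply: cvgB.
      apply: (@continuous_entry _ _ _ _ (A \o fst)) => q.
      exact: (continuous_comp cvg_fst (contA _)).
    apply: cvgMn.
    exact: (continuous_comp cvg_snd (@real_complex_continuous R _)).
  have clz : closed [set 0 : C].
    exact/accessible_closed_set1/hausdorff_accessible/norm_hausdorff.
  by apply: (preimage_closed _ clz) => p _; exact: contD.
have cptK : compact (K `&` Z).
  apply: compact_closedI => //; apply: compact_setX; last exact: segment_compact.
  exact: brillouin_box_compact.
have K0 : (K `&` Z) (0, x0).
  split; last exact/ZE.
  split=> [j|]; rewrite /= in_itv /= ?mxE ?lexx ?mulr_ge0 ?pi_ge0 //.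
  by rewrite -ler_norml.
have [[k x] /set_mem[_ /ZE Akx] xmin] :
    exists2 p, p \in K `&` Z & forall q, q \in K `&` Z -> `|p.2| <= `|q.2|.
  apply: compact_EVT_min => //; first by exists (0, x0).
  apply: continuous_subspaceT => p.
  exact: (continuous_comp cvg_snd (@norm_continuous _ R _)).
exists `|x|; split; first by exists x%:C; [exists k | rewrite normr_real_complex].
move=> _ [e [k1 Ae] <-]; have [y ey] := eigR _ _ Ae; rewrite {e}ey in Ae *.
rewrite normr_real_complex lecR.
(* An energy beyond the cutoff exceeds [x0] in modulus, and [x0] itself competes in the minimum; any
   other energy is moved into the box. *)
have [yx0|x0y] := leP `|y| `|x0|; last first.
  by apply: le_trans (ltW x0y); exact: (xmin _ (mem_set K0)).
have [k2 Bk2 Ak2] := translation_invariant_box k1 perA.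
apply: (xmin (k2, y)); apply: mem_set; split; last by apply/ZE; rewrite Ak2.
by split => //=; rewrite in_itv /= -ler_norml.
Qed.

End EnergyGap.

(** * Straight-line paths of Hamiltonians, the onsite potential, and time reversal of forms *)

Section Interpolation.
Context {R : realType} {d : nat}.
Local Notation C := (Cplx R).
Local Open Scope classical_set_scope.
Local Open Scope complex_scope.

Definition lerp (s : R) n (A B : 'rV[R]_d -> 'M[C]_n) (k : 'rV[R]_d) : 'M[C]_n :=
  (1 - s)%:C *: A k + s%:C *: B k.

Lemma lerp0 n (A B : 'rV[R]_d -> 'M[C]_n) : lerp 0 A B = A.
Proof. by apply/funext => k; rewrite /lerp subr0 scale0r addr0 scale1r. Qed.

Lemma lerp1 n (A B : 'rV[R]_d -> 'M[C]_n) : lerp 1 A B = B.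
Proof. by apply/funext => k; rewrite /lerp subrr scale0r add0r scale1r. Qed.

Lemma conj_real_complex (x : R) : Num.conj (x%:C : C) = x%:C.
Proof. by apply/CrealP; rewrite complex_real. Qed.

(** Parameter and momentum both depend on [t]: a constant [f] gives continuity in the momentum at
    fixed [s], and the two projections give joint continuity of the path. *)
Lemma lerp_continuous (T : topologicalType) (f : T -> R) (g : T -> 'rV[R]_d) n
    (A B : 'rV[R]_d -> 'M[C]_n) :
  continuous f -> continuous g -> continuous A -> continuous B ->
  continuous (fun t => lerp (f t) A B (g t)).
Proof.
move=> cf cg cA cB; apply: continuous_mx => i j t.
under eq_fun do rewrite !mxE.
have entry (M : 'rV[R]_d -> 'M[C]_n) : continuous M ->
    {for t, continuous (fun t => M (g t) i j)}.
  move=> cM; apply: (@continuous_entry _ _ _ _ (M \o g)) => t'.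
  exact: (continuous_comp (cg _) (cM _)).
have cplx (h : T -> R) : continuous h ->
    {for t, continuous (fun t => (h t)%:C : C)}.
  by move=> ch; exact: (continuous_comp (ch _) (@real_complex_continuous R _)).
apply: cvgD; apply: cvgM; [|exact: entry|exact: cplx|exact: entry].
by apply: (cplx (fun t => 1 - f t)) => t'; apply: cvgB; [exact: cvg_cst|exact: cf].
Qed.

Lemma periodic_hermitian_lerp s n (A B : 'rV[R]_d -> 'M[C]_n) :
  periodic_hermitian A -> periodic_hermitian B -> periodic_hermitian (lerp s A B).
Proof.
move=> [[cA pA] hA] [[cB pB] hB]; split; last first.
  move=> k; rewrite hermsymmxE linearD !linearZ /= map_mxD !map_mxZ.
  by rewrite /= !conj_real_complex !hermsymmx_tr.
split=> [k|k j]; last by rewrite /lerp pA pB.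
apply: (@lerp_continuous _ (fun=> s) id) => // k'.
  exact: (@cst_continuous _ R).
by move=> P.
Qed.

(** Time reversal is antilinear, but the weights are real and therefore fixed by conjugation. *)
Lemma tr_conj_lerp s n (V : 'M[C]_n) (A B : 'rV[R]_d -> 'M[C]_n) :
  tr_conj V (lerp s A B) = lerp s (tr_conj V A) (tr_conj V B).
Proof.
apply/funext => k; rewrite /tr_conj /lerp map_mxD !map_mxZ /= !conj_real_complex.
by rewrite mulmxDr -!scalemxAr mulmxDl -!scalemxAl.
Qed.

Lemma tr_even_lerp s n (V : 'M[C]_n) (A B : 'rV[R]_d -> 'M[C]_n) :
  tr_even V A -> tr_even V B -> tr_even V (lerp s A B).
Proof. by move=> eA eB k; rewrite tr_conj_lerp /lerp eA eB. Qed.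

Lemma tr_odd_lerp s n (V : 'M[C]_n) (A B : 'rV[R]_d -> 'M[C]_n) :
  tr_odd V A -> tr_odd V B -> tr_odd V (lerp s A B).
Proof. by move=> oA oB k; rewrite tr_conj_lerp /lerp oA oB !scalerN opprD. Qed.

Lemma is_bdg_data_lerp s N (V : 'M[C]_N)
    (A B D E A' B' D' E' : 'rV[R]_d -> 'M[C]_N) :
  is_bdg_data V A B D E -> is_bdg_data V A' B' D' E' ->
  is_bdg_data V (lerp s A A') (lerp s B B') (lerp s D D') (lerp s E E').
Proof.
move=> [[pA eA] [pB oB] [pD eD] [pE eE]] [[pA' eA'] [pB' oB'] [pD' eD'] [pE' eE']].
split; split; try exact: periodic_hermitian_lerp; try exact: tr_even_lerp.
exact: tr_odd_lerp.
Qed.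

(** [bdg] is linear in its four fields, so a segment between two BdG Hamiltonians can be followed
    field by field and stays of BdG form. *)
Lemma bdg_lerp s N (A B D E A' B' D' E' : 'rV[R]_d -> 'M[C]_N) :
  lerp s (bdg A B D E) (bdg A' B' D' E') =
  bdg (lerp s A A') (lerp s B B') (lerp s D D') (lerp s E E').
Proof.
apply/funext => k; rewrite /lerp /bdg !scale_block_mx add_block_mx.
apply: (f_equal4 (@block_mx _ _ _ _ _)).
- by rewrite !scalerDr addrACA.
- by rewrite !scalerDr !scalerN !scalerA ![_ * 'i]mulrC addrACA opprD.
- by rewrite !scalerDr !scalerA ![_ * 'i]mulrC addrACA.
- by rewrite !scalerDr !scalerN opprD addrACA.
Qed.

Lemma periodic_hermitian_bdg N (V : 'M[C]_N) (A B D E : 'rV[R]_d -> 'M[C]_N) :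
  is_bdg_data V A B D E -> periodic_hermitian (bdg A B D E).
Proof.
move=> [[[[cA pA] hA] _] [[[cB pB] hB] _] [[[cD pD] hD] _] [[[cE pE] hE] _]].
split; last by move=> k; exact: hermsymmx_bdg.
split=> [|k j]; last by rewrite /bdg pA pB pD pE.
have entry (M : 'rV[R]_d -> 'M[C]_N) i j (cM : continuous M) :
    continuous (fun k => M k i j) by exact: continuous_entry.
apply: continuous_mx => i j k.
case: (split_ordP i) => i' ->; case: (split_ordP j) => j' ->.
- under eq_fun do rewrite block_mxEul !mxE.
  exact: (cvgD (entry _ _ _ cA k) (entry _ _ _ cB k)).
- under eq_fun do rewrite block_mxEur !mxE.
  apply: (cvgB (entry _ _ _ cD k)).
  exact: (cvgM (cvg_cst _) (entry _ _ _ cE k)).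
- under eq_fun do rewrite block_mxEdl !mxE.
  apply: (cvgD (entry _ _ _ cD k)).
  exact: (cvgM (cvg_cst _) (entry _ _ _ cE k)).
- under eq_fun do rewrite block_mxEdr !mxE.
  exact: (cvgD (cvgN (entry _ _ _ cA k)) (entry _ _ _ cB k)).
Qed.

Lemma periodic_hermitian_cst n (M : 'M[C]_n) :
  M \is hermsymmx -> periodic_hermitian (fun _ : 'rV[R]_d => M).
Proof.
by move=> hM; split=> //; split=> // k; exact: (@cst_continuous _ 'M[C]_n).
Qed.

Lemma onsite_potentialE N :
  @onsite_potential R d N = bdg (fun=> 1%:M) (fun=> 0) (fun=> 0) (fun=> 0).
Proof. by apply/funext => k; rewrite /bdg !scaler0 subr0 !addr0. Qed.

Lemma is_bdg_data_onsite N (V : 'M[C]_N) : V \in unitmx ->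
  is_bdg_data V (fun _ : 'rV[R]_d => 1%:M) (fun=> 0) (fun=> 0) (fun=> 0).
Proof.
move=> Vu; have h1 : periodic_hermitian (fun _ : 'rV[R]_d => 1%:M : 'M[C]_N).
  by apply: periodic_hermitian_cst; rewrite hermsymmxE trmx1 map_mx1.
have h0 : periodic_hermitian (fun _ : 'rV[R]_d => 0 : 'M[C]_N).
  by apply: periodic_hermitian_cst; rewrite hermsymmxE trmx0 map_mx0.
by split; split=> // k; rewrite /tr_conj ?map_mx1 ?map_mx0 ?mulmx1 ?mulmxV //
  mulmx0 mul0mx ?oppr0.
Qed.

(** The matrix tau_z is real and commutes with the block-diagonal [W]. *)
Lemma tr_symmetric_onsite N (V : 'M[C]_N) :
  V \in unitmx -> tr_symmetric V (@onsite_potential R d N).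
Proof.
move=> Vu k; rewrite /tr_conj /onsite_potential; set W := block_mx V 0 0 V.
have Wu : W \in unitmx by rewrite unitmxE det_ublock unitrM -!unitmxE Vu.
rewrite map_block_mx map_mxN map_mx1 map_mx0; set T := block_mx 1%:M _ _ _.
suff -> : W *m T = T *m W by rewrite mulmxK.
rewrite !mulmx_block !mulmx0 !mul0mx !mulmxN !mulNmx.
by rewrite !mulmx1 !mul1mx !addr0 !add0r.
Qed.

(** The potential squares to the identity, so it has no kernel. *)
Lemma onsite_potential_eigenvalue_neq0 N k E :
  eigenvalue (@onsite_potential R d N k) E -> E != 0.
Proof.
move=> /eigenvalueP[v vT v0]; apply: contra_neq v0 => E0.
have TT : onsite_potential N k *m onsite_potential N k = 1%:M.
  rewrite mulmx_block !mulmx0 !mul0mx mulNmx mulmxN opprK !mulmx1 !addr0 !add0r.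
  by rewrite [RHS]scalar_mx_block.
by rewrite -[v]mulmx1 -TT mulmxA vT E0 scale0r mul0mx.
Qed.

Lemma smallest_eigenvalue_qform n (A : 'rV[R]_d -> 'M[C]_n) (l : R) k x :
  A k \is hermsymmx -> smallest_eigenvalue A l ->
  l%:C * sqnorm x <= qform (A k) x.
Proof.
move=> hA [_ lA]; apply: qform_ge_eigenvalue => // a Aa.
by apply: lA; exists k.
Qed.

(** Time reversal evaluates [A] at [- k], so the bound is assumed at every momentum; the vector
    plugged into the form changes by a unitary and a conjugation, which preserve its norm. *)
Lemma qform_tr_conj n (V : 'M[C]_n) (A : 'rV[R]_d -> 'M[C]_n) (l : C) :
  V \is unitarymx -> (forall k, A k \is hermsymmx) ->
  (forall k x, l * sqnorm x <= qform (A k) x) ->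
  forall k x, l * sqnorm x <= qform (tr_conj V A k) x.
Proof.
move=> Vu hA lA k x; rewrite /tr_conj qform_conj //.
suff -> : sqnorm x = sqnorm (map_mx Num.conj (x *m V)) by [].
rewrite -(sqnorm_unitary x Vu) !sqnormE.
by apply: eq_bigr => i _; rewrite [in RHS]mxE norm_conjC.
Qed.

End Interpolation.

(** * The gap bound for BdG Hamiltonians and the deformation to the onsite potential *)

Section Gap.
Context {R : realType} {d N : nat}.
Local Notation C := (Cplx R).
Local Open Scope classical_set_scope.
Local Open Scope complex_scope.
Variables (V : 'M[C]_N) (H0 HM D1 D2 : 'rV[R]_d -> 'M[C]_N).
Hypotheses (hV : time_reversal V) (hH : is_bdg_data V H0 HM D1 D2).

Lemma bdg_qform_ge (lp lm : R) :
  smallest_eigenvalue (fun k => D1 k + HM k) lp ->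
  smallest_eigenvalue (fun k => D1 k - HM k) lm ->
  forall k x, (Num.max lp lm)%:C * sqnorm x <= qform (D1 k + HM k) x /\
              (Num.max lp lm)%:C * sqnorm x <= qform (D1 k - HM k) x.
Proof.
have [Vu _] := hV; have [_ [[_ hM] oM] [[_ hD] eD] _] := hH.
have hp k : D1 k + HM k \is hermsymmx.
  by rewrite hermsymmxE linearD map_mxD /= !hermsymmx_tr.
have hm k : D1 k - HM k \is hermsymmx.
  by rewrite hermsymmxE linearB map_mxB /= !hermsymmx_tr.
have trp k : tr_conj V (fun k => D1 k + HM k) k = D1 k - HM k.
  by rewrite -eD -oM /tr_conj map_mxD mulmxDr mulmxDl.
have trm k : tr_conj V (fun k => D1 k - HM k) k = D1 k + HM k.
  by rewrite -[HM k]opprK -eD -oM /tr_conj map_mxB mulmxBr mulmxBl.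
move=> /(smallest_eigenvalue_qform _ (hp _)) bp.
move=> /(smallest_eigenvalue_qform _ (hm _)) bm k x.
have bp' := qform_tr_conj Vu hp bp k x.
have bm' := qform_tr_conj Vu hm bm k x.
rewrite trp in bp'; rewrite trm in bm'.
(* Whichever of [lp] and [lm] is larger bounds its own combination directly and the other one
   through time reversal; this is what allows the maximum instead of the minimum. *)
case: leP => _; split; [exact: bm'|exact: bm|exact: bp|exact: bp'].
Qed.

Lemma bdg_spectrum_norm_ge (l : C) k E :
  (forall x, l * sqnorm x <= qform (D1 k + HM k) x) ->
  (forall x, l * sqnorm x <= qform (D1 k - HM k) x) ->
  eigenvalue (bdg H0 HM D1 D2 k) E -> l <= `|E|.
Proof.
by apply: bdg_eigenvalue_norm; have [_] := periodic_hermitian_bdg hH; apply.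
Qed.

(** The energy gap is an attained minimum, so it is positive as soon as no eigenvalue vanishes; no
    uniform bound over the torus has to be supplied. *)
Lemma bdg_gapped : (0 < N)%N ->
  (forall k E, eigenvalue (bdg H0 HM D1 D2 k) E -> E != 0) ->
  gapped (bdg H0 HM D1 D2).
Proof.
move=> N_gt0 nz; have NN_gt0 : (0 < N + N)%N by rewrite addn_gt0 N_gt0.
have [EG hEG] := periodic_hermitian_energy_gap NN_gt0 (periodic_hermitian_bdg hH).
exists EG => //; have [[E [k HE] EEG] _] := hEG.
by rewrite -ltcR -EEG normr_gt0 (nz k).
Qed.

End Gap.

Theorem theorem1 (R : realType) (d N : nat) (hN : (0 < N)%N)
    (V : 'M[Cplx R]_N) (hV : time_reversal V)
    (H0 HM D1 D2 : 'rV[R]_d -> 'M[Cplx R]_N)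
    (hH : is_bdg_data V H0 HM D1 D2)
    (lp lm EG : R)
    (hlp : smallest_eigenvalue (fun k => D1 k + HM k) lp)
    (hlm : smallest_eigenvalue (fun k => D1 k - HM k) lm)
    (hEG : energy_gap (bdg H0 HM D1 D2) EG) :
  Num.max lp lm <= EG /\
  (0 < Num.max lp lm -> topologically_trivial V (bdg H0 HM D1 D2)).
Proof.
have qge := bdg_qform_ge hV hH hlp hlm; set l := Num.max lp lm in qge *.
have le_lEG : l <= EG.
  have [[E [k HE] EEG] _] := hEG.
  have := bdg_spectrum_norm_ge hH (fun x => (qge k x).1) (fun x => (qge k x).2) HE.
  by rewrite EEG lecR.
split=> // l_gt0; split; first by exists EG => //; exact: lt_le_trans le_lEG.
have Vu : V \in unitmx by case: hV => /unitarymx_unit.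
pose Hs s := lerp s (bdg H0 HM D1 D2) (@onsite_potential R d N).
exists Hs; split; rewrite /Hs ?lerp0 ?lerp1 //; last first.
- by move=> symH s _; apply: tr_even_lerp => //; exact: tr_symmetric_onsite.
- move=> s; rewrite inE /= => /andP[s_ge0 s_le1].
  have hs := is_bdg_data_lerp s hH (is_bdg_data_onsite Vu).
  rewrite onsite_potentialE bdg_lerp; split.
    by do 4!eexists; split; first exact: hs.
  apply: (bdg_gapped hs hN) => k E.
  (* The lower bound [(1 - s) * l] degenerates at [s = 1], so that endpoint is settled
     separately. *)
  have [->|s_neq1] := eqVneq s 1.
    rewrite -bdg_lerp lerp1 -onsite_potentialE.
    exact: onsite_potential_eigenvalue_neq0.
  have s_lt1 : 0 < 1 - s by rewrite subr_gt0 lt_neqAle s_neq1.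
  have ls_gt0 : 0 < ((1 - s) * l)%:C%C :> Cplx R by rewrite ltcR mulr_gt0.
  (* The target has zero [HM] and [D1] parts, so along the path [D1 + HM] and [D1 - HM] are merely
     scaled by [1 - s], and so are their forms; [M] stands for either of them. *)
  suff bound (A B M : 'M[Cplx R]_N) x : A + B = (1 - s)%:C%C *: M ->
      l%:C%C * sqnorm x <= qform M x ->
      ((1 - s) * l)%:C%C * sqnorm x <= qform (A + B) x.
    rewrite -normr_gt0 => HE; apply: lt_le_trans ls_gt0 _.
    apply: (bdg_spectrum_norm_ge hs _ _ HE) => x; have [qp qm] := qge k x.
      by apply: bound qp; rewrite /lerp !scaler0 !addr0 scalerDr.
    by apply: bound qm; rewrite /lerp !scaler0 !addr0 scalerBr.
  move=> -> qM; rewrite /qform -scalemxAr -scalemxAl mxE rmorphM -mulrA.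
  by rewrite ler_wpM2l // ler0c ltW.
- apply: continuous_subspaceT; have [[contH _] _] := periodic_hermitian_bdg hH.
  apply: (@lerp_continuous _ _ _ fst snd).
  + by move=> p; exact: cvg_fst.
  + by move=> p; exact: cvg_snd.
  + exact: contH.
  + by move=> k; exact: (@cst_continuous _ 'M[Cplx R]_(N + N)).
Qed.
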